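(* Consider the linear stochastic system, the open-loop problem and the closed-loop indirect-feedback MPC algorithm described in the context. Let $(\mathbf{X}^s,\mathbf{U}^s)$ be a stationary pair with $|\ell(\mathbf{X}^s,\mathbf{U}^s)|<\infty$ and assume that the following holds. (i) The set $\mathbb{Z}_f\subseteq\mathbb{R}^n$ is nonempty, and for all $z\in\mathbb{Z}_f$ and $i=1,\ldots,m_x$: $c_i^\top z\le p_i-\sup_{j\in\mathbb{N}_0}\rho(c_i^\top E_j)$. (ii) There exists $v_f\in\mathbb{V}$ such that for all $z\in\mathbb{Z}_f$: $(A+BK)z+Bv_f+\mathbb{E}[W(0)]\in\mathbb{Z}_f$, and $d_i^\top(Kz+v_f)\le q_i-\sup_{j\in\mathbb{N}_0}\rho(d_i^\top KE_j)$ for $i=1,\ldots,m_u$. (iii) There is a constant $C_f\ge0$ such that, with $v_f$ from (ii), for all $X\in\mathcal{R}(\Omega,\mathbb{R}^n)$ (independent of $W(N)$) $$F(AX+B(KX+v_f)+W(N))\le F(X)-\ell(X,KX+v_f)+\ell(\mathbf{X}^s,\mathbf{U}^s)+C_f .$$ (iv) The stochastic optimal control problem is stochastically dissipative at $(\mathbf{X}^s,\mathbf{U}^s)$. (v) The initial state is feasible, i.e. the open-loop problem is feasible at time $j=0$. Then the closed-loop solution has near-optimal averaged performance, i.e. $$\ell(\mathbf{X}^s,\mathbf{U}^s)\le\liminf_{L\to\infty}\frac1L\sum_{k=0}^{L-1}\ell(X^{cl}(k),U^{cl}(k))\le\limsup_{L\to\infty}\frac1L\sum_{k=0}^{L-1}\ell(X^{cl}(k),U^{cl}(k))\le\ell(\mathbf{X}^s,\mathbf{U}^s)+C_f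 .$$ Moreover, if (iii) holds with $C_f=0$, then $$\lim_{L\to\infty}\frac1L\sum_{k=0}^{L-1}\ell(X^{cl}(k),U^{cl}(k))=\ell(\mathbf{X}^s,\mathbf{U}^s).$$
   Context: Setting. $(\Omega,\mathcal{F},\mathbb{P})$ is a probability space and $\mathcal{R}(\Omega,\mathcal{Y})$ is the set of $\mathcal{Y}$-valued random variables. $A\in\mathbb{R}^{n\times n}$, $B\in\mathbb{R}^{n\times l}$, $(A,B)$ controllable. The system is $X(k+1)=AX(k)+BU(k)+W(k)$, $X(0)=X_0\in\mathcal{R}(\Omega,\mathbb{R}^n)$, where $W(0),W(1),\ldots$ are i.i.d. $\mathbb{R}^n$-valued random variables with finite mean (not necessarily Gaussian), $\mathcal{F}_k=\sigma(X(0),\ldots,X(k))$, controls are adapted ($\sigma(U(k))\subseteq\mathcal{F}_k$), and $W(k)$ is independent of $X(k)$ and of every admissible (i.e. $\mathcal{F}_k$-measurable) $U(k)$, so $W(k)$ is independent of $\mathcal{F}_k$. The stage cost is $\ell(X,U)=\mathbb{E}[g(X,U)]$ with $g:\mathbb{R}^n\times\mathbb{R}^l\to\mathbb{R}$ continuous and bounded from below; the terminal cost is $F(X)=\mathbb{E}[g_f(X)]$ with $g_f:\mathbb{R}^n\to\mathbb{R}$. Constraints. $\rho:\mathcal{R}(\Omega,\mathbb{R})\to\mathbb{R}\cup\{+\infty\}$ is translative ($\rho(Y+c)=\rho(Y)+c$ for $c\in\mathbb{R}$), monotone ($\rho(Y_1)\ge\rho(Y_2)$ if $Y_1\ge Y_2$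 a.s.) and law-invariant ($\rho(Y)=\rho(Z)$ if $Y\sim Z$). Given are $c_i\in\mathbb{R}^n$, $p_i\in\mathbb{R}$ ($i=1,\ldots,m_x$) and $d_i\in\mathbb{R}^l$, $q_i\in\mathbb{R}$ ($i=1,\ldots,m_u$). The risk-averse constraints are $\rho(c_i^\top X(k))\le p_i$ ($i=1,\ldots,m_x$), $\rho(d_i^\top U(k))\le q_i$ ($i=1,\ldots,m_u$). The stochastic optimal control problem is to minimize $\sum_k\ell(X(k),U(k))$ over adapted control sequences subject to the system dynamics and these constraints at all times. Stationary pair. A pair of processes $(\mathbf{X}^s,\mathbf{U}^s)$ with $X^s(k+1)=AX^s(k)+BU^s(k)+W(k)$ and $U^s(k)=\pi^s(X^s(k))$ for a feedback map $\pi^s$ is stationary if $X^s(k)$, $U^s(k)$ satisfy the risk-averse constraints for all $k$ and there are probability distributions $P^s_X,P^s_U,P^s_{X,U}$ with $X^s(k)\sim P^s_X$, $U^s(k)\sim P^s_U$, $(X^s(k),U^s(k))\sim P^s_{X,U}$ for all $k\in\mathbb{N}_0$. Then $\ell(\mathbf{X}^s,\mathbf{U}^s)$ denotes the ($k$-independent) value $\ell(X^s(k),U^s(k))$. Stochastic dissipativity. The problem is stochastically dissipative at a stationary pair $(\mathbf{X}^s,\mathbf{U}^s)$ with $|\ell(\mathbf{X}^s,\mathbf{U}^s)|<\infty$ if there exists a law-invariant function $\lambda:\mathcal{R}(\Omega,\mathbb{R}^n)\to\mathbb{R}$, bounded from below, such that $\ell(X(k),U(k))-\ell(\mathbf{X}^s,\mathbf{U}^s)+\lambda(X(k))-\lambda(AX(k)+BU(k)+W(k))\ge0$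 for all $k\in\mathbb{N}_0$ and all $X(k),U(k)$ satisfying the adaptedness condition and the constraints. Open-loop problem. Fix a stabilizing gain $K\in\mathbb{R}^{l\times n}$ (all eigenvalues of $A+BK$ lie in the open unit disc), $\mathbb{V}\subseteq\mathbb{R}^l$, $\mathbb{Z}_f\subseteq\mathbb{R}^n$ and a horizon $N\in\mathbb{N}$, $N\ge1$. At time $j$, for data $x_j\in\mathbb{R}^n$, $z_j\in\mathbb{R}^n$, $E_j\in\mathcal{R}(\Omega,\mathbb{R}^n)$, minimize over $\mathbf{v}=(v_0,\ldots,v_{N-1})\in\mathbb{V}^N$ the cost $\sum_{k=0}^{N-1}\ell(X(k),U(k))+F(X(N))$ subject to: $X(0)=x_j$, $X(k+1)=(A+BK)X(k)+Bv_k+W(j+k)$, $U(k)=KX(k)+v_k$; $z(0)=z_j$, $z(k+1)=(A+BK)z(k)+Bv_k+\mathbb{E}[W(j+k)]$; $E(0)=E_j$, $E(k+1)=(A+BK)E(k)+W(j+k)-\mathbb{E}[W(j+k)]$; $z(N)\in\mathbb{Z}_f$; and for $k=0,\ldots,N-1$: $c_i^\top z(k)\le p_i-\rho(c_i^\top E(k))$ ($i=1,\ldots,m_x$), $d_i^\top(Kz(k)+v_k)\le q_i-\rho(d_i^\top KE(k))$ ($i=1,\ldots,m_u$). The problem is feasible if some $\mathbf{v}$ satisfies all these constraints. Closed-loop algorithm. Initialize $X^{cl}(0)=X_0$, $Z^{cl}(0)=z_0=\mathbb{E}[X_0]$, $E_0=X_0-z_0$. For $j=0,1,\ldots$ and each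 $\omega$: with $x_j=X^{cl}(j,\omega)$, $z_j=Z^{cl}(j,\omega)$, solve the open-loop problem for $(x_j,z_j,E_j)$ to obtain an optimal solution $\mathbf{v}^*=(v_0^*,\ldots,v_{N-1}^* )$ (an optimal solution is presumed to exist whenever the problem is feasible); set $V^{cl}(j,\omega)=v_0^*$, $U^{cl}(j,\omega)=Kx_j+v_0^*$, $Z^{cl}(j+1,\omega)=(A+BK)z_j+Bv_0^*+\mathbb{E}[W(j)]$, $X^{cl}(j+1,\omega)=Ax_j+BU^{cl}(j,\omega)+W(j,\omega)$; and, as random variable, $E_{j+1}=(A+BK)E_j+W(j)-\mathbb{E}[W(j)]$. The controls are chosen measurably, so that $U^{cl}(j)$ and $Z^{cl}(j+1)$ are measurable with respect to $\sigma(X^{cl}(0),\ldots,X^{cl}(j))$.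
   Formalization: The formal theorem additionally assumes that g_f is measurable and bounded from below, and that in (v) the expected optimal open-loop cost at time 0 is finite; without the lower bound on g_f or this finiteness the upper performance bound can fail. *)

(* Defs.v *)
From HB Require Import structures.
From mathcomp Require Import all_boot all_order all_algebra.
From mathcomp Require Import all_classical all_reals all_analysis.
From mathcomp.real_closed Require Import complex.

Set Implicit Arguments.
Unset Strict Implicit.
Unset Printing Implicit Defensive.

Import Order.TTheory GRing.Theory Num.Theory.
Import numFieldNormedType.Exports.

Local Open Scope classical_set_scope.
Local Open Scope ring_scope.
Local Open Scope ereal_scope.

(* R^n is 'cV[R]_n with its Borel sigma-algebra.  A random vector is a map
   X : Omega -> 'cV[R]_n that is measurable for it; functionals on spaces of
   random variables (rho, lambda) are functions of arbitrary maps on Omega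
   which are only constrained, and only evaluated, on measurable ones. *)
Notation borel T := (g_sigma_algebraType (@open T)).

Section linear_algebra.
Context {R : realType} {n l : nat}.

Definition dotv {m : nat} (c x : 'cV[R]_m) : R := (c^T *m x) ord0 ord0.

Definition controllable (A : 'M[R]_n) (B : 'M[R]_(n, l)) : Prop :=
  \rank (\mxrow_(k < n) (A ^+ k *m B)%R) = n.

Definition schur_stable (M : 'M[R]_n) : Prop :=
  forall z : R[i], eigenvalue (map_mx (real_complex R) M) z -> (`|z| < 1)%R.

End linear_algebra.

Section random_vectors.
Context {disp : measure_display} {Omega : measurableType disp} {R : realType}.
Variable P : probability Omega R.

Definition random_vector {T : ptopologicalType} (X : Omega -> T) : Prop :=
  measurable_fun [set: Omega] (X : Omega -> borel T).

Definition sigma_of {T : ptopologicalType} (X : Omega -> T) : set (set Omega) :=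
  g_sigma_algebra_preimage (X : Omega -> borel T).

(* sigma(X(0), ..., X(k)) *)
Definition history {T : ptopologicalType} (X : nat -> Omega -> T) (k : nat) :
    set (set Omega) :=
  <<s \bigcup_(i in [set i | (i <= k)%N]) sigma_of (X i) >>.

Definition has_law {d' : measure_display} {T : measurableType d'}
    (X : Omega -> T) (Q : probability T R) : Prop :=
  forall S : set T, measurable S -> P (X @^-1` S) = Q S.

Definition same_law {d' : measure_display} {T : measurableType d'}
    (X Y : Omega -> T) : Prop :=
  forall S : set T, measurable S -> P (X @^-1` S) = P (Y @^-1` S).

Definition independent (G H : set (set Omega)) : Prop :=
  forall S T : set Omega, G S -> H T -> P (S `&` T) = P S * P T.

Definition iid {T : ptopologicalType} (W : nat -> Omega -> T) : Prop :=
  (forall (s : seq nat) (S : nat -> set Omega), uniq s ->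
     (forall k, sigma_of (W k) (S k)) ->
     P (\bigcap_(k in [set` s]) S k) = \prod_(k <- s) P (S k)) /\
  (forall k, same_law (W k : Omega -> borel T) (W 0%N : Omega -> borel T)).

Definition finite_mean {m : nat} (X : Omega -> 'cV[R]_m) : Prop :=
  forall i, P.-integrable [set: Omega] (fun w => (X w i ord0)%:E).

Definition mean {m : nat} (X : Omega -> 'cV[R]_m) : 'cV[R]_m :=
  (\col_i fine 'E_P[fun w => X w i ord0])%R.

(* rho takes its values in R u {+oo} *)
Record risk_measure (rho : (Omega -> R) -> \bar R) : Prop := RiskMeasure {
  rho_gtNy : forall Y : Omega -> R, measurable_fun [set: Omega] Y ->
    -oo < rho Y;
  rho_translative : forall (Y : Omega -> R) (c : R),
    measurable_fun [set: Omega] Y ->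
    rho (fun w => Y w + c)%R = rho Y + c%:E;
  rho_monotone : forall Y1 Y2 : Omega -> R,
    measurable_fun [set: Omega] Y1 -> measurable_fun [set: Omega] Y2 ->
    {ae P, forall w, (Y2 w <= Y1 w)%R} -> rho Y2 <= rho Y1;
  rho_law_invariant : forall Y Z : Omega -> R,
    measurable_fun [set: Omega] Y -> measurable_fun [set: Omega] Z ->
    same_law Y Z -> rho Y = rho Z }.

End random_vectors.

Section optimal_control_problem.
Context {disp : measure_display} {Omega : measurableType disp} {R : realType}.
Variable P : probability Omega R.
Context {n l : nat}.
Variables (A : 'M[R]_n) (B : 'M[R]_(n, l)) (W : nat -> Omega -> 'cV[R]_n).
Variable g : 'cV[R]_n -> 'cV[R]_l -> R.
Context {mx mu : nat}.
Variable rho : (Omega -> R) -> \bar R.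
Variables (c : 'I_mx -> 'cV[R]_n) (p : 'I_mx -> R).
Variables (d : 'I_mu -> 'cV[R]_l) (q : 'I_mu -> R).

Definition stage_cost (X : Omega -> 'cV[R]_n) (U : Omega -> 'cV[R]_l) : \bar R :=
  'E_P[fun w => g (X w) (U w)].

Definition system_process (X : nat -> Omega -> 'cV[R]_n)
    (U : nat -> Omega -> 'cV[R]_l) : Prop :=
  [/\ random_vector (X 0%N),
      forall k, sigma_of (U k) `<=` history X k &
      forall k w, X k.+1 w = (A *m X k w + B *m U k w + W k w)%R].

Definition noise_independent (X : nat -> Omega -> 'cV[R]_n) : Prop :=
  forall k, independent P (history X k) (sigma_of (W k)).

Definition risk_constraints (X : Omega -> 'cV[R]_n) (U : Omega -> 'cV[R]_l) :
    Prop :=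
  (forall i, rho (fun w => dotv (c i) (X w)) <= (p i)%:E) /\
  (forall i, rho (fun w => dotv (d i) (U w)) <= (q i)%:E).

Definition ocp_admissible (X0 : Omega -> 'cV[R]_n)
    (X : nat -> Omega -> 'cV[R]_n) (U : nat -> Omega -> 'cV[R]_l) : Prop :=
  [/\ system_process X U, X 0%N = X0 & forall k, risk_constraints (X k) (U k)].

Record stationary_pair (Xs : nat -> Omega -> 'cV[R]_n)
    (Us : nat -> Omega -> 'cV[R]_l) : Prop := StationaryPair {
  stat_process : system_process Xs Us;
  stat_noise : noise_independent Xs;
  stat_feedback : exists pi : 'cV[R]_n -> 'cV[R]_l,
    forall k w, Us k w = pi (Xs k w);
  stat_constraints : forall k, risk_constraints (Xs k) (Us k);
  stat_law_X : exists Q : probability (borel 'cV[R]_n) R,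
    forall k, has_law P (Xs k : Omega -> borel 'cV[R]_n) Q;
  stat_law_U : exists Q : probability (borel 'cV[R]_l) R,
    forall k, has_law P (Us k : Omega -> borel 'cV[R]_l) Q;
  stat_law_XU : exists Q : probability (borel ('cV[R]_n * 'cV[R]_l)%type) R,
    forall k, has_law P
      ((fun w => (Xs k w, Us k w)) : Omega -> borel ('cV[R]_n * 'cV[R]_l)%type)
      Q }.

(* By stationarity the value at time 0 is the value at all times. *)
Definition stationary_cost (Xs : nat -> Omega -> 'cV[R]_n)
    (Us : nat -> Omega -> 'cV[R]_l) : \bar R := stage_cost (Xs 0%N) (Us 0%N).

Definition stochastically_dissipative (X0 : Omega -> 'cV[R]_n)
    (Xs : nat -> Omega -> 'cV[R]_n) (Us : nat -> Omega -> 'cV[R]_l) : Prop :=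
  exists lambda : (Omega -> 'cV[R]_n) -> R,
  [/\ forall X Y : Omega -> 'cV[R]_n, random_vector X -> random_vector Y ->
        same_law P (X : Omega -> borel 'cV[R]_n) (Y : Omega -> borel 'cV[R]_n) ->
        lambda X = lambda Y,
      exists b : R, forall X, random_vector X -> (b <= lambda X)%R &
      forall X U, ocp_admissible X0 X U -> forall k,
        0 <= stage_cost (X k) (U k) - stationary_cost Xs Us + (lambda (X k))%:E
             - (lambda (fun w => A *m X k w + B *m U k w + W k w)%R)%:E].

End optimal_control_problem.

Section indirect_feedback_mpc.
Context {disp : measure_display} {Omega : measurableType disp} {R : realType}.
Variable P : probability Omega R.
Context {n l : nat}.
Variables (A : 'M[R]_n) (B : 'M[R]_(n, l)) (K : 'M[R]_(l, n)).
Variables (W : nat -> Omega -> 'cV[R]_n) (X0 : Omega -> 'cV[R]_n).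
Variables (g : 'cV[R]_n -> 'cV[R]_l -> R) (gf : 'cV[R]_n -> R).
Context {mx mu : nat}.
Variable rho : (Omega -> R) -> \bar R.
Variables (c : 'I_mx -> 'cV[R]_n) (p : 'I_mx -> R).
Variables (d : 'I_mu -> 'cV[R]_l) (q : 'I_mu -> R).
Variables (V : set 'cV[R]_l) (Zf : set 'cV[R]_n) (N : nat).

Definition terminal_cost (X : Omega -> 'cV[R]_n) : \bar R :=
  'E_P[fun w => gf (X w)].

Local Notation AK := (A + B *m K)%R.

Fixpoint err (j : nat) : Omega -> 'cV[R]_n :=
  if j is j'.+1 then fun w => (AK *m err j' w + W j' w - mean P (W j'))%R
  else fun w => (X0 w - mean P X0)%R.

(* An input sequence (v_0, ..., v_(N-1)) is a function on nat of which only the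
   values below N are used. *)
Section open_loop.
Variable j : nat.
Implicit Types (x z : 'cV[R]_n) (E : Omega -> 'cV[R]_n) (v : nat -> 'cV[R]_l).

Fixpoint ol_X x v (k : nat) : Omega -> 'cV[R]_n :=
  if k is k'.+1 then
    fun w => (AK *m ol_X x v k' w + B *m v k' + W (j + k')%N w)%R
  else fun=> x.

Definition ol_U x v (k : nat) : Omega -> 'cV[R]_l :=
  fun w => (K *m ol_X x v k w + v k)%R.

Fixpoint ol_z z v (k : nat) : 'cV[R]_n :=
  if k is k'.+1 then
    (AK *m ol_z z v k' + B *m v k' + mean P (W (j + k')%N))%R
  else z.

Fixpoint ol_E E (k : nat) : Omega -> 'cV[R]_n :=
  if k is k'.+1 then
    fun w => (AK *m ol_E E k' w + W (j + k')%N w - mean P (W (j + k')%N))%R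
  else E.

Definition ol_cost x v : \bar R :=
  \sum_(0 <= k < N) stage_cost P g (ol_X x v k) (ol_U x v k)
  + terminal_cost (ol_X x v N).

Definition ol_feasible z E v : Prop :=
  [/\ forall k, (k < N)%N -> V (v k),
      Zf (ol_z z v N) &
      forall k, (k < N)%N ->
        (forall i, (dotv (c i) (ol_z z v k))%:E
                   <= (p i)%:E - rho (fun w => dotv (c i) (ol_E E k w))) /\
        (forall i, (dotv (d i) (K *m ol_z z v k + v k)%R)%:E
                   <= (q i)%:E - rho (fun w => dotv (d i) (K *m ol_E E k w)))].

Definition ol_optimal x z E v : Prop :=
  ol_feasible z E v /\
  forall v', ol_feasible z E v' -> ol_cost x v <= ol_cost x v'.

Definition ol_value x z E : \bar R :=
  ereal_inf [set ol_cost x v | v in [set v | ol_feasible z E v]].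

End open_loop.

(* v j w is the input sequence selected at time j in the scenario w. *)
Record closed_loop (X : nat -> Omega -> 'cV[R]_n) (U : nat -> Omega -> 'cV[R]_l)
    (Z : nat -> Omega -> 'cV[R]_n) (v : nat -> Omega -> nat -> 'cV[R]_l) : Prop :=
  ClosedLoop {
  cl_X0 : X 0%N = X0;
  cl_Z0 : forall w, Z 0%N w = mean P X0;
  cl_optimal : forall j w,
    (exists v', ol_feasible j (Z j w) (err j) v') ->
    ol_optimal j (X j w) (Z j w) (err j) (v j w);
  cl_U : forall j w, U j w = (K *m X j w + v j w 0%N)%R;
  cl_ZS : forall j w,
    Z j.+1 w = (AK *m Z j w + B *m v j w 0%N + mean P (W j))%R;
  cl_XS : forall j w, X j.+1 w = (A *m X j w + B *m U j w + W j w)%R;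
  cl_measurable : forall j k, (k < N)%N ->
    sigma_of (fun w => v j w k) `<=` history X j }.

Definition terminal_state_condition : Prop :=
  Zf !=set0 /\
  forall z, Zf z -> forall i,
    (dotv (c i) z)%:E
    <= (p i)%:E - ereal_sup (range (fun j => rho (fun w => dotv (c i) (err j w)))).

Definition terminal_input_condition (vf : 'cV[R]_l) : Prop :=
  forall z, Zf z ->
    Zf (AK *m z + B *m vf + mean P (W 0%N))%R /\
    forall i,
      (dotv (d i) (K *m z + vf)%R)%:E
      <= (q i)%:E
         - ereal_sup (range (fun j => rho (fun w => dotv (d i) (K *m err j w)))).

(* The inequality is required for those X for which the difference
   F(X) - l(X, KX + v_f) is not of the form +oo - (+oo). *)
Definition terminal_cost_condition (ls : \bar R) (vf : 'cV[R]_l) (C : R) : Prop :=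
  forall X : Omega -> 'cV[R]_n, random_vector X ->
    independent P (sigma_of X) (sigma_of (W N)) ->
    let U := fun w => (K *m X w + vf)%R in
    terminal_cost X +? - stage_cost P g X U ->
    terminal_cost (fun w => A *m X w + B *m U w + W N w)%R
    <= terminal_cost X - stage_cost P g X U + ls + C%:E.

End indirect_feedback_mpc.

Definition average_cost {disp : measure_display} {Omega : measurableType disp}
    {R : realType} (P : probability Omega R) {n l : nat}
    (g : 'cV[R]_n -> 'cV[R]_l -> R) (X : nat -> Omega -> 'cV[R]_n)
    (U : nat -> Omega -> 'cV[R]_l) (L : nat) : \bar R :=
  (L%:R^-1)%:E * \sum_(0 <= k < L) stage_cost P g (X k) (U k).

(* Main.v *)
Require Import Defs.
From HB Require Import structures.
From mathcomp Require Import all_boot all_order all_algebra.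
From mathcomp Require Import all_classical all_reals all_analysis.
From mathcomp Require Import measurable_realfun lra.

Import Order.TTheory GRing.Theory Num.Theory.
Import numFieldNormedType.Exports.

Local Open Scope classical_set_scope.
Local Open Scope ring_scope.
Local Open Scope ereal_scope.

(** Lower bound: along trajectories [Xcl = Zcl + err], so the tightened
    constraints on [Zcl], valid for every scenario, give the risk constraints for
    [Xcl] and [Ucl] by monotonicity and translativity of [rho]; the closed loop is
    thus admissible for the dissipation inequality, which telescopes.

    Upper bound: after subtracting lower bounds, the costs are nonnegative.  Since
    the noise is i.i.d., the open-loop cost at any time [j] equals one
    time-invariant functional [cost_to_go N x v] defined by dynamic programming.
    Condition (iii) at constant random vectors bounds the cost of the shifted input
    extended by [vf] pointwise, and averaging out [W j], which is independent of
    the history, yields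
      [E cost_to_go N (Xcl j.+1) + l (Xcl j, Ucl j) <=
       E cost_to_go N (Xcl j) + l (Xs, Us) + Cf],
    which telescopes because [E cost_to_go N (Xcl 0)] is finite. *)

(** * Measurability of random vectors, reduced to coordinates *)

Section measurable_vectors.
Context {R : realType}.

(** The base sets need not be open. What matters is that every open set is the union of the
    countably many base sets it contains, so that measurability need only be checked on base
    sets. *)
Definition countable_local_base {T : topologicalType} {I : countType}
    (B : I -> set T) : Prop :=
  forall x A, nbhs x A -> exists2 i, B i x & B i `<=` A.

Lemma measurable_preimage_open {d} {S : measurableType d} {T : topologicalType}
    {I : countType} {B : I -> set T} (f : S -> T) (O : set T) :
  countable_local_base B -> (forall i, measurable (f @^-1` B i)) ->
  open O -> measurable (f @^-1` O).
Proof.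
move=> hB mB oO.
have -> : f @^-1` O =
    \bigcup_i (if `[< B i `<=` O >] then f @^-1` B i else set0).
  apply/seteqP; split=> [s Os|s [i _]].
    have [i Bi BO] := hB (f s) O (open_nbhs_nbhs (conj oO Os)).
    by exists i => //; rewrite (asboolT BO).
  by case: ifP => // /asboolP BO /BO.
apply: countable_bigcupT_measurable; first exact: countableP.
by move=> i; case: ifP.
Qed.

Definition rational_box {n : nat} (i : 'cV[rat * rat]_n) : set 'cV[R]_n :=
  [set x | forall k, (ratr (i k ord0).1 < x k ord0 < ratr (i k ord0).2)%R].

Lemma rational_box_base (n : nat) : countable_local_base (@rational_box n).
Proof.
move=> x A [P hP PA].
have [i hi] : exists i : 'I_n -> rat * rat, forall k,
    (ratr (i k).1 < x k ord0 < ratr (i k).2)%R /\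
    forall y : R, (ratr (i k).1 < y < ratr (i k).2)%R -> P k ord0 y.
  suff h k : exists i : rat * rat, (ratr i.1 < x k ord0 < ratr i.2)%R /\
    forall y : R, (ratr i.1 < y < ratr i.2)%R -> P k ord0 y.
    exists (fun k => projT1 (cid (h k))) => k.
    by case: (cid (h k)).
  have [e /= e0 he] := (nbhs_ballP _ _).1 (hP k ord0).
  have [a /itvP ha] : exists a, ratr a \in `]x k ord0 - e, x k ord0[%R.
    by apply: rat_in_itvoo; rewrite ltrBlDr ltrDl.
  have [b /itvP hb] : exists b, ratr b \in `]x k ord0, x k ord0 + e[%R.
    by apply: rat_in_itvoo; rewrite ltrDl.
  exists (a, b); split=> /= [|y /andP[ay yb]]; first by rewrite ha hb.
  apply: he; rewrite /ball/= distrC ltr_distl; apply/andP; split.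
    by apply: le_lt_trans ay; rewrite ltW ?ha.
  by apply: (lt_trans yb); rewrite hb.
exists (\col_k i k).
  by move=> k; rewrite mxE; exact: (hi k).1.
move=> y hy; apply: PA => k j; rewrite (ord1 j); apply: (hi k).2.
by have := hy k; rewrite mxE.
Qed.

Lemma setX_base {T1 T2 : topologicalType} {I1 I2 : countType}
    (B1 : I1 -> set T1) (B2 : I2 -> set T2) :
  countable_local_base B1 -> countable_local_base B2 ->
  countable_local_base (fun i : I1 * I2 => B1 i.1 `*` B2 i.2).
Proof.
move=> h1 h2 [x1 x2] A [[/= P Q] [/= hP hQ] PQ].
have [i1 xi1 i1P] := h1 _ _ hP; have [i2 xi2 i2Q] := h2 _ _ hQ.
by exists (i1, i2) => //= -[y1 y2] [/= /i1P ? /i2Q ?]; apply: PQ.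
Qed.

Context {d : measure_display} {S : measurableType d}.

Definition entrywise_measurable {n : nat} (x : S -> 'cV[R]_n) : Prop :=
  forall i, measurable_fun [set: S] (fun s => x s i ord0).

Lemma measurable_rational_box {n : nat} (x : S -> 'cV[R]_n) i :
  entrywise_measurable x -> measurable (x @^-1` rational_box i).
Proof.
move=> mx.
have -> : x @^-1` rational_box i = \bigcap_(k in [set: 'I_n])
    ((fun s => x s k ord0) @^-1` `]ratr (i k ord0).1, ratr (i k ord0).2[).
  apply/seteqP; split=> [s h k _ /=|s h k].
    by rewrite in_itv/=; exact: h.
  by have /= := h k I; rewrite in_itv.
apply: fin_bigcap_measurable; first exact: finite_finset.
by move=> k _; rewrite -[_ @^-1` _]setTI; apply: mx.
Qed.

Lemma continuous_entrywise {n : nat} (i : 'I_n) (j : 'I_1) :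
  continuous (fun x : 'cV[R]_n => x i j).
Proof.
move=> x A hA; exists (fun i' j' => if (i' == i) then A else setT).
  move=> i' j'; case: eqP => [->|_]; last exact: filterT.
  by rewrite (ord1 j') -(ord1 j).
by move=> y /(_ i j); rewrite eqxx.
Qed.

(** Coordinates are continuous, hence Borel, which gives one direction. Conversely, open sets are
    countable unions of rational boxes, and the preimage of a box is a finite intersection of
    coordinate preimages. *)
Lemma random_vectorE {n : nat} (x : S -> 'cV[R]_n) :
  random_vector x <-> entrywise_measurable x.
Proof.
split=> [mx i|mx].
  apply: (measurability _ (RGenOpens.measurableE R)).
  move=> _ [_ [a [b ->] <-]].
  have := mx measurableT ((fun y : 'cV[R]_n => y i ord0) @^-1` `]a, b[%classic).
  apply; apply: sub_gen_smallest.
  by have /continuousP := @continuous_entrywise n i ord0; apply; exact: interval_open.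
apply: (@measurability _ _ _ (borel 'cV[R]_n) _ x (@open 'cV[R]_n)) => //.
move=> _ [D oD <-]; rewrite setTI.
apply: (measurable_preimage_open _ _ (rational_box_base n)) => // i.
exact: measurable_rational_box.
Qed.

Lemma entrywise_cst {n : nat} (x : 'cV[R]_n) :
  entrywise_measurable (fun=> x : 'cV[R]_n).
Proof. by move=> i; exact: measurable_cst. Qed.

Lemma entrywiseD {n : nat} (x y : S -> 'cV[R]_n) :
  entrywise_measurable x -> entrywise_measurable y ->
  entrywise_measurable (fun s => x s + y s)%R.
Proof.
move=> mx my i; rewrite (_ : (fun s => _) =
    (fun s => x s i ord0) \+ (fun s => y s i ord0))%R.
  exact: measurable_funD.
by apply/funext => s; rewrite mxE.
Qed.

Lemma entrywiseM {m n : nat} (M : 'M[R]_(m, n)) (x : S -> 'cV[R]_n) :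
  entrywise_measurable x -> entrywise_measurable (fun s => M *m x s)%R.
Proof.
move=> mx i; rewrite (_ : (fun s => _) =
    (fun s => \sum_(k <- enum 'I_n) M i k * x s k ord0)%R).
  by apply: measurable_sum => k; apply: measurable_funM => //; exact: measurable_cst.
by apply/funext => s; rewrite mxE big_enum.
Qed.

Lemma entrywiseB {n : nat} (x y : S -> 'cV[R]_n) :
  entrywise_measurable x -> entrywise_measurable y ->
  entrywise_measurable (fun s => x s - y s)%R.
Proof.
move=> mx my; apply: entrywiseD => //.
rewrite (_ : (fun s => _) = (fun s => (- 1%:M) *m y s)%R).
  exact: entrywiseM.
by apply/funext => s; rewrite mulNmx mul1mx.
Qed.

Lemma measurable_dotv {n : nat} (c : 'cV[R]_n) (x : S -> 'cV[R]_n) :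
  entrywise_measurable x -> measurable_fun [set: S] (fun s => dotv c (x s)).
Proof. move=> mx; have h := entrywiseM (c^T)%R _ mx; exact: h ord0. Qed.

(** Works with products of rational boxes as a base of the product topology, so the Borel
    sigma-algebra of the product is never compared with the product sigma-algebra. *)
Lemma measurable_continuous2 {n m : nat} (g : 'cV[R]_n -> 'cV[R]_m -> R)
    (x : S -> 'cV[R]_n) (u : S -> 'cV[R]_m) :
  continuous (fun y : 'cV[R]_n * 'cV[R]_m => g y.1 y.2) ->
  entrywise_measurable x -> entrywise_measurable u ->
  measurable_fun [set: S] (fun s => g (x s) (u s)).
Proof.
move=> cg mx mu.
apply: (measurability _ (RGenOpens.measurableE R)).
move=> _ [_ [a [b ->] <-]]; rewrite setTI.
have /continuousP/(_ `]a, b[%classic) oG := cg.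
have {}oG := oG ltac:(exact: interval_open).
pose xu s := (x s, u s).
suff h i : measurable (xu @^-1` (rational_box i.1 `*` rational_box i.2)).
  exact: (measurable_preimage_open xu _
    (setX_base _ _ (rational_box_base n) (rational_box_base m)) h oG).
case: i => i j.
have -> : xu @^-1` (rational_box i `*` rational_box j) =
  x @^-1` rational_box i `&` u @^-1` rational_box j by [].
by apply: measurableI; exact: measurable_rational_box.
Qed.

Lemma measurable_borel_comp {n : nat} (h : 'cV[R]_n -> R) (x : S -> 'cV[R]_n) :
  measurable_fun [set: borel 'cV[R]_n] (h : borel 'cV[R]_n -> R) ->
  entrywise_measurable x -> measurable_fun [set: S] (fun s => h (x s)).
Proof.
move=> mh /random_vectorE mx.
exact: (@measurableT_comp _ _ _ _ (borel 'cV[R]_n) _ h _ x).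
Qed.

End measurable_vectors.

Lemma entrywise_comp {R : realType} {d d'} {S : measurableType d}
    {S' : measurableType d'} {n : nat} (x : S' -> 'cV[R]_n) (f : S -> S') :
  measurable_fun [set: S] f -> entrywise_measurable x ->
  entrywise_measurable (fun s => x (f s)).
Proof. by move=> mf mx i; exact: (measurableT_comp (mx i) mf). Qed.

(** * Integrals of shifted, equally distributed and independent variables *)

Section probability.
Context {disp : measure_display} {Omega : measurableType disp} {R : realType}.
Variable P : probability Omega R.

(** For [r < 0] the sum may change sign while [f] may have infinite integral, so additivity does not
    apply directly. The negative part of [f + r] is at most [- r], hence has finite integral and can
    be moved across an equation. *)
Lemma integral_addr (f : Omega -> \bar R) (r : R) :
  measurable_fun [set: Omega] f -> (forall w, 0 <= f w) ->
  \int[P]_w (f w + r%:E) = \int[P]_w f w + r%:E.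
Proof.
move=> mf f0.
have Pcst (s : R) : \int[P]_(_ in [set: Omega]) s%:E = s%:E.
  by rewrite integral_cst//= probability_setT mule1.
have [r0|r0] := leP 0%R r.
  by rewrite ge0_integralD//= ?Pcst// => w _; rewrite lee_fin.
pose h w := f w + r%:E.
have mh : measurable_fun [set: Omega] h by apply: emeasurable_funD.
(* All four terms are nonnegative, so both sides can be integrated term by term. *)
have hE w : f w + h^\- w = h^\+ w + (- r)%:E.
  rewrite funeposE funenegE /h; have := f0 w; case: (f w) => [a| |]//.
    rewrite lee_fin => a0.
    rewrite -!EFinD -EFinN -!EFin_max -!EFinD; congr (_%:E).
    by case: (leP (a + r)%R 0%R) => h0; case: (leP (- (a + r))%R 0%R) => h1; lra.
  by move=> _; rewrite (addye (x := r%:E))// maxNye maxye !addye.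
have := eq_integral (mu := P) (D := [set: Omega])
  (fun w => h^\+ w + (- r)%:E) (fun w => f w + h^\- w) (fun w _ => hE w).
rewrite ge0_integralD//=; last exact: measurable_funeneg.
rewrite ge0_integralD//=; last 2 first.
  exact: measurable_funepos.
  by move=> w _; rewrite lee_fin; lra.
rewrite Pcst [in RHS]/= => {}hE.
rewrite integralE -/h.
have fin : \int[P]_w h^\- w \is a fin_num.
  rewrite ge0_fin_numE; last exact: integral_ge0.
  apply: (@le_lt_trans _ _ (\int[P]_(_ in [set: Omega]) (- r)%:E)); last first.
    by rewrite Pcst ltry.
  apply: ge0_le_integral => //=.
  - exact: measurable_funeneg.
  - move=> w _; rewrite funenegE /h; have := f0 w; case: (f w) => [a| |]//=.
      rewrite lee_fin => a0; rewrite -EFin_max lee_fin.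
      by rewrite ge_max; apply/andP; split; lra.
    by move=> _; rewrite maxNye lee_fin; lra.
move: fin hE; have : 0 <= \int[P]_w h^\+ w by exact: integral_ge0.
have : 0 <= \int[P]_w f w by exact: integral_ge0.
case: (\int[P]_w f w) => [a| |]//; case: (\int[P]_w h^\+ w) => [b| |]//;
case: (\int[P]_w h^\- w) => [e| |]// _ _ _ //=.
by rewrite -!EFinD => -[] hE; congr (_%:E); lra.
Qed.

Lemma ge0_integral_same_law {d} {T : measurableType d} (Y Y' : Omega -> T)
    (f : T -> \bar R) :
  measurable_fun [set: Omega] Y -> measurable_fun [set: Omega] Y' ->
  same_law P Y Y' -> measurable_fun [set: T] f -> (forall y, 0 <= f y) ->
  \int[P]_w f (Y w) = \int[P]_w f (Y' w).
Proof.
move=> mY mY' YY' mf f0.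
pose Y1 : {mfun Omega >-> T} := HB.pack Y (isMeasurableFun.Build _ _ _ _ _ mY).
pose Y2 : {mfun Omega >-> T} := HB.pack Y' (isMeasurableFun.Build _ _ _ _ _ mY').
transitivity (\int[distribution P Y1]_y f y).
  by rewrite ge0_integral_distribution.
transitivity (\int[distribution P Y2]_y f y).
  by apply: eq_measure_integral => S mS _; exact: YY'.
by rewrite ge0_integral_distribution.
Qed.

Lemma integral_same_law {d} {T : measurableType d} (Y Y' : Omega -> T)
    (f : T -> \bar R) :
  measurable_fun [set: Omega] Y -> measurable_fun [set: Omega] Y' ->
  same_law P Y Y' -> measurable_fun [set: T] f ->
  \int[P]_w f (Y w) = \int[P]_w f (Y' w).
Proof.
move=> mY mY' YY' mf; rewrite integralE [RHS]integralE; congr (_ - _).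
- have posE (Z : Omega -> T) w : (fun w => f (Z w))^\+ w = f^\+ (Z w).
    by rewrite !funeposE.
  rewrite (eq_integral _ _ (fun w _ => posE Y w)).
  rewrite [RHS](eq_integral _ _ (fun w _ => posE Y' w)).
  by apply: ge0_integral_same_law => //; exact: measurable_funepos.
- have negE (Z : Omega -> T) w : (fun w => f (Z w))^\- w = f^\- (Z w).
    by rewrite !funenegE.
  rewrite (eq_integral _ _ (fun w _ => negE Y w)).
  rewrite [RHS](eq_integral _ _ (fun w _ => negE Y' w)).
  by apply: ge0_integral_same_law => //; exact: measurable_funeneg.
Qed.

(** By independence the law of [(xi, Y)] is a product measure, and its second factor is also the law
    of [Y']; Tonelli's theorem then gives the iterated integral. *)
Lemma indep_integral_pair {d d'} {S : measurableType d} {T : measurableType d'}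
    (xi : Omega -> S) (Y Y' : Omega -> T) (f : S * T -> \bar R) :
  measurable_fun [set: Omega] xi -> measurable_fun [set: Omega] Y ->
  measurable_fun [set: Omega] Y' -> same_law P Y Y' ->
  (forall C D, measurable C -> measurable D ->
    P (xi @^-1` C `&` Y @^-1` D) = P (xi @^-1` C) * P (Y @^-1` D)) ->
  measurable_fun [set: S * T] f -> (forall y, 0 <= f y) ->
  \int[P]_w f (xi w, Y w) = \int[P]_w \int[P]_w' f (xi w, Y' w').
Proof.
move=> mxi mY mY' YY' ind mf f0.
pose X1 : {mfun Omega >-> S} := HB.pack xi (isMeasurableFun.Build _ _ _ _ _ mxi).
pose Y2 : {mfun Omega >-> T} := HB.pack Y' (isMeasurableFun.Build _ _ _ _ _ mY').
pose Z := fun w => (xi w, Y w).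
have mZ : measurable_fun [set: Omega] Z by exact: measurable_fun_pair.
pose Z1 : {mfun Omega >-> (S * T)%type} :=
  HB.pack Z (isMeasurableFun.Build _ _ _ _ _ mZ).
transitivity (\int[distribution P Z1]_z f z).
  by rewrite ge0_integral_distribution.
transitivity (\int[distribution P X1 \x distribution P Y2]_z f z).
  apply: eq_measure_integral => C mC _; symmetry.
  apply: product_measure_unique => // C1 D1 mC1 mD1.
  exact: etrans (ind _ _ mC1 mD1) (congr1 (mule _) (YY' _ mD1)).
rewrite fubini_tonelli1//.
rewrite ge0_integral_distribution; last 2 first.
- exact: measurable_fun_fubini_tonelli_F.
- by move=> y; apply: integral_ge0.
apply: eq_integral => w _ /=.
rewrite /fubini_F ge0_integral_distribution//.
exact: measurableT_comp (measurable_pair1 _).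
Qed.

End probability.

(** * The information carried by past states *)

Section history.
Context {disp : measure_display} {Omega : measurableType disp} {R : realType}.
Variable P : probability Omega R.
Context {n : nat}.
Implicit Type X : nat -> Omega -> 'cV[R]_n.

(** [Omega] with the coarser sigma-algebra [history X k]. Adaptedness becomes ordinary measurability
    on this type, and [idfun] into it plays the role of the random variable that carries the
    available information. *)
Definition history_type X (k : nat) :=
  g_sigma_algebraType (\bigcup_(i in [set i | (i <= k)%N]) sigma_of (X i)).

Lemma measurable_to_history X k :
  (forall i, (i <= k)%N -> random_vector (X i)) ->
  measurable_fun [set: Omega] (idfun : Omega -> history_type X k).
Proof.
move=> mX.
apply: (@measurability _ _ _ (history_type X k) _ _
  (\bigcup_(i in [set i | (i <= k)%N]) sigma_of (X i))) => //.
move=> _ [C [i /= ik [D mD <-]] <-].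
by rewrite setTI setTI; have := mX i ik measurableT D mD; rewrite setTI.
Qed.

Lemma process_history X k i : (i <= k)%N ->
  entrywise_measurable (X i : history_type X k -> 'cV[R]_n).
Proof.
move=> ik; apply/random_vectorE => _ D mD.
by apply: sub_gen_smallest; exists i => //; exists D.
Qed.

Lemma history_measurableP {m : nat} X k (U : Omega -> 'cV[R]_m) :
  sigma_of U `<=` history X k <->
  entrywise_measurable (U : history_type X k -> 'cV[R]_m).
Proof.
split=> [hU|/random_vectorE mU _ [D mD <-]]; last exact: mU.
by apply/random_vectorE => _ D mD; apply: hU; exists D.
Qed.

Lemma history_entrywise {m : nat} X k (U : Omega -> 'cV[R]_m) :
  (forall i, (i <= k)%N -> random_vector (X i)) ->
  entrywise_measurable (U : history_type X k -> 'cV[R]_m) ->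
  entrywise_measurable U.
Proof. by move=> mX; exact: entrywise_comp (measurable_to_history X k mX). Qed.

Lemma history_independent X k (Y : Omega -> 'cV[R]_n) :
  independent P (history X k) (sigma_of Y) ->
  forall (C : set (history_type X k)) (D : set (borel 'cV[R]_n)),
  measurable C -> measurable D ->
  P (idfun @^-1` C `&` Y @^-1` D) = P (idfun @^-1` C) * P (Y @^-1` D).
Proof.
by move=> ind C D mC mD; apply: ind => //; exists D => //; rewrite setTI.
Qed.

End history.

(** * A time-invariant cost defined by dynamic programming *)

Section cost_to_go.
Context {disp : measure_display} {Omega : measurableType disp} {R : realType}.
Variable P : probability Omega R.
Context {n l : nat}.
Variables (A : 'M[R]_n) (B : 'M[R]_(n, l)) (K : 'M[R]_(l, n)).
Variables (W0 : Omega -> 'cV[R]_n).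
Variables (g : 'cV[R]_n -> 'cV[R]_l -> R) (gf : 'cV[R]_n -> R).

Local Notation AK := (A + B *m K)%R.

(* Every step is averaged over the law of the single vector [W0], which makes the
   functional independent of time. *)
Fixpoint cost_to_go (m : nat) (x : 'cV[R]_n) (v : nat -> 'cV[R]_l) : \bar R :=
  if m is m'.+1 then
    (g x (K *m x + v 0%N)%R)%:E +
    \int[P]_w cost_to_go m' (AK *m x + B *m v 0%N + W0 w)%R (fun k => v k.+1)
  else (gf x)%:E.

Lemma cost_to_goS m x v : cost_to_go m.+1 x v =
  (g x (K *m x + v 0%N)%R)%:E +
  \int[P]_w cost_to_go m (AK *m x + B *m v 0%N + W0 w)%R (fun k => v k.+1).
Proof. by []. Qed.

Lemma eq_cost_to_go m x (v v' : nat -> 'cV[R]_l) :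
  (forall k, (k < m)%N -> v k = v' k) -> cost_to_go m x v = cost_to_go m x v'.
Proof.
elim: m x v v' => // m IH x v v' vv' /=.
rewrite vv'//; congr (_ + _); apply: eq_integral => w _.
by apply: IH => k km; exact: vv'.
Qed.

Hypothesis mW0 : random_vector W0.
Hypothesis cg : continuous (fun y : 'cV[R]_n * 'cV[R]_l => g y.1 y.2).
Hypothesis g0 : forall x u, (0 <= g x u)%R.
Hypothesis mgf : measurable_fun [set: borel 'cV[R]_n] (gf : borel 'cV[R]_n -> R).
Hypothesis gf0 : forall x, (0 <= gf x)%R.

Lemma cost_to_go_ge0 m x v : 0 <= cost_to_go m x v.
Proof.
elim: m x v => [|m IH] x v /=; first by rewrite lee_fin.
by apply: adde_ge0; [rewrite lee_fin|apply: integral_ge0].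
Qed.

Lemma measurable_stage {d} {S : measurableType d} (x : S -> 'cV[R]_n)
    (u : S -> 'cV[R]_l) :
  entrywise_measurable x -> entrywise_measurable u ->
  measurable_fun [set: S] (fun s => (g (x s) (K *m x s + u s)%R)%:E).
Proof.
move=> mx mu; apply/measurable_EFinP.
by apply: measurable_continuous2 => //; apply: entrywiseD => //; exact: entrywiseM.
Qed.

(** The induction ranges over all measurable spaces [S]: the next noise becomes a further parameter,
    the induction hypothesis is used on [S * Omega], and Tonelli's theorem integrates the noise out
    again. *)
Lemma measurable_cost_to_go m {d} {S : measurableType d} (x : S -> 'cV[R]_n)
    (v : S -> nat -> 'cV[R]_l) :
  entrywise_measurable x ->
  (forall k, (k < m)%N -> entrywise_measurable (fun s => v s k)) ->
  measurable_fun [set: S] (fun s => cost_to_go m (x s) (v s)).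
Proof.
elim: m d S x v => [|m IH] d S x v mx mv /=.
  by apply/measurable_EFinP; exact: measurable_borel_comp.
apply: emeasurable_funD; first by apply: measurable_stage => //; exact: mv.
pose f (z : S * Omega) := cost_to_go m
  (AK *m x z.1 + B *m v z.1 0%N + W0 z.2)%R (fun k => v z.1 k.+1).
apply: (measurable_fun_fubini_tonelli_F f) => [|z]; last exact: cost_to_go_ge0.
have mfst : measurable_fun [set: S * Omega] fst by exact: measurable_fst.
apply: IH => [|k km]; last exact: (entrywise_comp (fun s => v s k.+1) _ mfst (mv _ _)).
apply: entrywiseD.
  apply: entrywiseD; apply: entrywiseM.
    exact: (entrywise_comp _ _ mfst mx).
  exact: (entrywise_comp (fun s => v s 0%N) _ mfst (mv _ _)).
by apply: (entrywise_comp _ _ measurable_snd); apply/random_vectorE.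
Qed.

(* One step of the dynamics: the noise entering next may be averaged out
   beforehand because it is independent of the current information [xi]. *)
Lemma cost_to_go_step m {d} {S : measurableType d} (xi : Omega -> S)
    (Y : Omega -> 'cV[R]_n) (x : S -> 'cV[R]_n) (v : S -> nat -> 'cV[R]_l) :
  measurable_fun [set: Omega] xi -> random_vector Y ->
  same_law P (Y : Omega -> borel 'cV[R]_n) (W0 : Omega -> borel 'cV[R]_n) ->
  (forall (C : set S) (D : set (borel 'cV[R]_n)), measurable C -> measurable D ->
    P (xi @^-1` C `&` Y @^-1` D) = P (xi @^-1` C) * P (Y @^-1` D)) ->
  entrywise_measurable x ->
  (forall k, (k < m.+1)%N -> entrywise_measurable (fun s => v s k)) ->
  \int[P]_w cost_to_go m.+1 (x (xi w)) (v (xi w)) =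
  \int[P]_w (g (x (xi w)) (K *m x (xi w) + v (xi w) 0%N)%R)%:E +
  \int[P]_w cost_to_go m (AK *m x (xi w) + B *m v (xi w) 0%N + Y w)%R
    (fun k => v (xi w) k.+1).
Proof.
move=> mxi mY YW0 ind mx mv.
pose f (z : S * borel 'cV[R]_n) := cost_to_go m
  (AK *m x z.1 + B *m v z.1 0%N + z.2)%R (fun k => v z.1 k.+1).
have mf : measurable_fun [set: S * borel 'cV[R]_n] f.
  have mfst : measurable_fun [set: S * borel 'cV[R]_n] fst by exact: measurable_fst.
  apply: measurable_cost_to_go => [|k km]; last first.
    exact: (entrywise_comp (fun s => v s k.+1) _ mfst (mv _ _)).
  apply: entrywiseD; last by apply/random_vectorE; exact: measurable_snd.
  apply: entrywiseD; apply: entrywiseM.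
    exact: (entrywise_comp _ _ mfst mx).
  exact: (entrywise_comp (fun s => v s 0%N) _ mfst (mv _ _)).
have f0 z : 0 <= f z by exact: cost_to_go_ge0.
have := indep_integral_pair P xi (Y : Omega -> borel 'cV[R]_n) W0 f
  mxi mY mW0 YW0 ind mf f0.
rewrite /f/= => ->; rewrite ge0_integralD//=.
- by move=> w _; rewrite lee_fin.
- apply: (measurable_stage (x \o xi) (fun w => v (xi w) 0%N)).
    exact: entrywise_comp.
  exact: (entrywise_comp (fun s => v s 0%N) _ mxi (mv _ _)).
- by move=> w _; apply: integral_ge0 => *; exact: cost_to_go_ge0.
- pose f' (z : S * Omega) := f (z.1, W0 z.2).
  have mf' : measurable_fun [set: S * Omega] f'.
    apply: (measurableT_comp mf); apply: measurable_fun_pair.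
      exact: measurable_fst.
    exact: (measurableT_comp mW0 measurable_snd).
  exact: (measurableT_comp
    (measurable_fun_fubini_tonelli_F f' mf' (fun z => f0 _)) mxi).
Qed.

(** The hypothesis is the case [m = 0]. An earlier stage adds the same term to both sides and
    averages the bound over the next state, which leaves the constant [e] unchanged. *)
Lemma cost_to_go_terminal (vf : 'cV[R]_l) (e : R) (m : nat) x v : (0 <= e)%R ->
  (forall y, (g y (K *m y + vf)%R)%:E +
    \int[P]_w (gf (AK *m y + B *m vf + W0 w)%R)%:E <= (gf y)%:E + e%:E) ->
  v m = vf -> cost_to_go m.+1 x v <= cost_to_go m x v + e%:E.
Proof.
move=> e0 hvf; elim: m x v => [|m IH] x v vm; first by rewrite /= vm; exact: hvf.
rewrite (cost_to_goS m.+1) (cost_to_goS m) -addeA.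
apply: leeD => //.
pose y w := (AK *m x + B *m v 0%N + W0 w)%R.
have my : entrywise_measurable y.
  by apply: entrywiseD; [exact: entrywise_cst|apply/random_vectorE].
have mctg k : measurable_fun [set: Omega]
    (fun w => cost_to_go k (y w) (fun i => v i.+1)).
  by apply: measurable_cost_to_go => // i _; exact: entrywise_cst.
rewrite -(integral_addr P _ e (mctg m)); last by move=> w; exact: cost_to_go_ge0.
apply: ge0_le_integral => //.
- by move=> w _; exact: cost_to_go_ge0.
- by apply: emeasurable_funD.
- by move=> w _; exact: IH.
Qed.

End cost_to_go.

(** * The open-loop cost expressed through [cost_to_go] *)

Section open_loop_cost.
Context {disp : measure_display} {Omega : measurableType disp} {R : realType}.
Variable P : probability Omega R.
Context {n l : nat}.
Variables (A : 'M[R]_n) (B : 'M[R]_(n, l)) (K : 'M[R]_(l, n)).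
Variables (W : nat -> Omega -> 'cV[R]_n) (X0 : Omega -> 'cV[R]_n).
Hypothesis mW : forall k, random_vector (W k).
Hypothesis WW0 : forall k,
  same_law P (W k : Omega -> borel 'cV[R]_n) (W 0%N : Omega -> borel 'cV[R]_n).

(* The uncontrolled process; its history contains that of the noise. *)
Fixpoint free_process (k : nat) : Omega -> 'cV[R]_n :=
  if k is k'.+1 then fun w => (A *m free_process k' w + W k' w)%R else X0.

Lemma free_system_process :
  random_vector X0 ->
  system_process A B W free_process (fun _ _ => 0%R).
Proof.
move=> mX0; split=> // [k|k w]; last by rewrite mulmx0 addr0.
by apply/history_measurableP; exact: entrywise_cst.
Qed.

Lemma free_process_measurable k :
  random_vector X0 -> random_vector (free_process k).
Proof.
move=> mX0; elim: k => //= k /random_vectorE IH; apply/random_vectorE.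
by apply: entrywiseD; [exact: entrywiseM|apply/random_vectorE].
Qed.

(** The noise is recovered from two consecutive states of the uncontrolled process. *)
Lemma noise_free_history k i : (k < i)%N ->
  entrywise_measurable (W k : history_type free_process i -> 'cV[R]_n).
Proof.
move=> ki.
rewrite (_ : W k = fun w => (free_process k.+1 w - A *m free_process k w)%R).
  apply: entrywiseB; first exact: process_history.
  by apply: entrywiseM; apply: process_history; exact: ltnW.
by apply/funext => w /=; rewrite addrC addKr.
Qed.

Lemma ol_X_free_history j x v k i : (j + k <= i)%N ->
  entrywise_measurable
    (ol_X A B K W j x v k : history_type free_process i -> 'cV[R]_n).
Proof.
elim: k i => [|k IH] i jki /=; first exact: entrywise_cst.
have jk : (j + k < i)%N by rewrite -addnS.
apply: entrywiseD; last exact: noise_free_history.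
apply: entrywiseD; last exact: entrywise_cst.
by apply: entrywiseM; exact: IH (ltnW jk).
Qed.

Lemma ol_X_measurable j x v k : entrywise_measurable (ol_X A B K W j x v k).
Proof.
elim: k => [|k IH] /=; first exact: entrywise_cst.
apply: entrywiseD; last by apply/random_vectorE.
by apply: entrywiseD; [exact: entrywiseM|exact: entrywise_cst].
Qed.

Lemma ol_U_measurable j x v k : entrywise_measurable (ol_U A B K W j x v k).
Proof.
apply: entrywiseD; last exact: entrywise_cst.
by apply: entrywiseM; exact: ol_X_measurable.
Qed.

(** The state predicted [k] steps after time [j] depends only on noise before time [j + k], hence is
    independent of [W (j + k)], which may thus be averaged out and replaced by a copy of [W 0]. *)
Lemma ol_cost_cost_to_go (g : 'cV[R]_n -> 'cV[R]_l -> R) (gf : 'cV[R]_n -> R) :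
  random_vector X0 -> noise_independent P W free_process ->
  continuous (fun y : 'cV[R]_n * 'cV[R]_l => g y.1 y.2) ->
  (forall x u, (0 <= g x u)%R) ->
  measurable_fun [set: borel 'cV[R]_n] (gf : borel 'cV[R]_n -> R) ->
  (forall x, (0 <= gf x)%R) ->
  forall N j x v,
  ol_cost P A B K W g gf N j x v = cost_to_go P A B K (W 0%N) g gf N x v.
Proof.
move=> mX0 ind cg g0 mgf gf0 N j x v.
set ctg := cost_to_go P A B K (W 0%N) g gf.
(* Interpolates between the two costs: [m = 0] gives the open-loop cost with horizon [k], while
   [k = 0] leaves [cost_to_go] alone. *)
suff main m k :
    \sum_(0 <= i < k) stage_cost P g (ol_X A B K W j x v i) (ol_U A B K W j x v i)
    + \int[P]_w ctg m (ol_X A B K W j x v k w) (fun i => v (k + i)%N)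
    = ctg (k + m)%N x v.
  by rewrite -[N in RHS]addn0 -main /ol_cost /terminal_cost expectation.unlock.
elim: k m => [|k IH] m.
  by rewrite big_geq// add0e/= integral_cst//= probability_setT mule1.
rewrite big_nat_recr// addSnnS -IH -addeA; congr (_ + _); symmetry.
have mid := measurable_to_history free_process (j + k)
  (fun i _ => free_process_measurable i mX0).
have := cost_to_go_step P A B K (W 0%N) g gf (mW 0%N) cg g0 mgf gf0 m
  (idfun : Omega -> history_type free_process (j + k)) (W (j + k)%N)
  (ol_X A B K W j x v k) (fun _ i => v (k + i)%N)
  mid (mW _) (WW0 _) (history_independent P _ _ _ (ind _))
  (ol_X_free_history _ _ _ _ _ (leqnn _)) (fun i _ => entrywise_cst _).
move=> ->; rewrite /stage_cost expectation.unlock /ol_U addn0.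
by congr (_ + _); apply: eq_integral => w _; apply: eq_cost_to_go => i _;
  rewrite addnS.
Qed.

Lemma stage_cost_addr (g : 'cV[R]_n -> 'cV[R]_l -> R) (b : R) X U :
  continuous (fun y : 'cV[R]_n * 'cV[R]_l => g y.1 y.2) ->
  (forall x u, (b <= g x u)%R) ->
  entrywise_measurable X -> entrywise_measurable U ->
  stage_cost P g X U = stage_cost P (fun x u => g x u - b)%R X U + b%:E.
Proof.
move=> cg gb mX mU; rewrite /stage_cost expectation.unlock -integral_addr.
- by apply: eq_integral => w _; rewrite -EFinD subrK.
- apply/measurable_EFinP; apply: measurable_funB; last exact: measurable_cst.
  exact: measurable_continuous2.
- by move=> w; rewrite lee_fin subr_ge0.
Qed.

Lemma terminal_cost_addr (gf : 'cV[R]_n -> R) (b : R) X :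
  measurable_fun [set: borel 'cV[R]_n] (gf : borel 'cV[R]_n -> R) ->
  (forall x, (b <= gf x)%R) -> entrywise_measurable X ->
  terminal_cost P gf X = terminal_cost P (fun x => gf x - b)%R X + b%:E.
Proof.
move=> mgf gb mX; rewrite /terminal_cost expectation.unlock -integral_addr.
- by apply: eq_integral => w _; rewrite -EFinD subrK.
- apply/measurable_EFinP; apply: measurable_funB; last exact: measurable_cst.
  exact: measurable_borel_comp.
- by move=> w; rewrite lee_fin subr_ge0.
Qed.

(** The correction does not depend on the input, so comparisons between inputs carry over to the
    nonnegative costs. *)
Lemma ol_cost_addr (g : 'cV[R]_n -> 'cV[R]_l -> R) (gf : 'cV[R]_n -> R)
    (b bf : R) N j x v :
  continuous (fun y : 'cV[R]_n * 'cV[R]_l => g y.1 y.2) ->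
  (forall x u, (b <= g x u)%R) ->
  measurable_fun [set: borel 'cV[R]_n] (gf : borel 'cV[R]_n -> R) ->
  (forall x, (bf <= gf x)%R) ->
  ol_cost P A B K W g gf N j x v =
  ol_cost P A B K W (fun x u => g x u - b)%R (fun x => gf x - bf)%R N j x v
  + (b *+ N + bf)%:E.
Proof.
move=> cg gb mgf gfb.
rewrite /ol_cost (terminal_cost_addr gf bf)//; last exact: ol_X_measurable.
rewrite EFinD addeACA; congr (_ + _).
elim: N => [|N IH]; first by rewrite !big_geq// add0e.
rewrite !big_nat_recr//= IH mulrSr EFinD addeACA; congr (_ + _).
by apply: stage_cost_addr => //; [exact: ol_X_measurable|exact: ol_U_measurable].
Qed.

End open_loop_cost.

(** * Constraint tightening *)

Lemma dotvD {R : realType} {n : nat} (c x y : 'cV[R]_n) :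
  dotv c (x + y)%R = (dotv c x + dotv c y)%R.
Proof. by rewrite /dotv mulmxDr mxE. Qed.

(** In every scenario [Y] is at most [E + (p - rho E)], whose risk is exactly [p] by
    translativity. *)
Lemma risk_le_of_tightened {disp : measure_display}
    {Omega : measurableType disp} {R : realType} (P : probability Omega R)
    (rho : (Omega -> R) -> \bar R) (Y E : Omega -> R) (p : R) :
  risk_measure P rho ->
  measurable_fun [set: Omega] Y -> measurable_fun [set: Omega] E ->
  (forall w, (Y w - E w)%:E <= p%:E - rho E) -> rho Y <= p%:E.
Proof.
move=> hrho mY mE YE.
(* If [rho E = +oo], the assumed bound reads [<= -oo], which is absurd in any scenario. *)
have := rho_gtNy hrho mE; case rE : (rho E) => [r| |]// _; last first.
  by have := YE point; rewrite rE.
have mEr : measurable_fun [set: Omega] (fun w => E w + (p - r))%R.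
  by apply: measurable_funD => //; exact: measurable_cst.
apply: (@le_trans _ _ (rho (fun w => E w + (p - r))%R)).
  apply: (rho_monotone hrho) => //; apply/aeW => w.
  by have := YE w; rewrite rE -EFinB lee_fin; lra.
by rewrite (rho_translative hrho)// rE -EFinD lee_fin; lra.
Qed.

(** * Feasibility, admissibility and cost of the closed loop *)

Section closed_loop_analysis.
Context {disp : measure_display} {Omega : measurableType disp} {R : realType}.
Variable P : probability Omega R.
Context {n l : nat}.
Variables (A : 'M[R]_n) (B : 'M[R]_(n, l)) (K : 'M[R]_(l, n)).
Variables (W : nat -> Omega -> 'cV[R]_n) (X0 : Omega -> 'cV[R]_n).
Variables (g : 'cV[R]_n -> 'cV[R]_l -> R) (gf : 'cV[R]_n -> R).
Variable rho : (Omega -> R) -> \bar R.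
Variables mx mu : nat.
Variables (c : 'I_mx -> 'cV[R]_n) (p : 'I_mx -> R).
Variables (d : 'I_mu -> 'cV[R]_l) (q : 'I_mu -> R).
Variables (V : set 'cV[R]_l) (Zf : set 'cV[R]_n) (N : nat).
Variables (Xcl : nat -> Omega -> 'cV[R]_n) (Ucl : nat -> Omega -> 'cV[R]_l).
Variables (Zcl : nat -> Omega -> 'cV[R]_n) (vstar : nat -> Omega -> nat -> 'cV[R]_l).
Variable vf : 'cV[R]_l.

Local Notation AK := (A + B *m K)%R.
Local Notation err := (err P A B K W X0).
Local Notation feasible := (ol_feasible P A B K W rho c p d q V Zf N).

Hypothesis mW : forall k, random_vector (W k).
Hypothesis WW0 : forall k,
  same_law P (W k : Omega -> borel 'cV[R]_n) (W 0%N : Omega -> borel 'cV[R]_n).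
Hypothesis mX0 : random_vector X0.
Hypothesis N0 : (0 < N)%N.
Hypothesis hcl :
  closed_loop P A B K W X0 g gf rho c p d q V Zf N Xcl Ucl Zcl vstar.

Lemma mean_noise k : mean P (W k) = mean P (W 0%N).
Proof.
apply/matrixP => i j; rewrite !mxE expectation.unlock; congr fine.
apply: (integral_same_law P (W k : Omega -> borel 'cV[R]_n)
  (W 0%N : Omega -> borel 'cV[R]_n) (fun y => (y i ord0)%:E) (mW k) (mW 0%N) (WW0 k)).
apply/measurable_EFinP.
have : entrywise_measurable (idfun : borel 'cV[R]_n -> 'cV[R]_n).
  by apply/random_vectorE; exact: measurable_id.
exact.
Qed.

Lemma ol_E_err j k : ol_E P A B K W j (err j) k = err (j + k).
Proof.
elim: k => [|k IH]; first by rewrite addn0.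
by rewrite addnS /= IH.
Qed.

Lemma ol_z_shift j z (v v' : nat -> 'cV[R]_l) k :
  (forall i, (i < k)%N -> v' i = v i.+1) ->
  ol_z P A B K W j.+1 (AK *m z + B *m v 0%N + mean P (W j))%R v' k =
  ol_z P A B K W j z v k.+1.
Proof.
elim: k => [|k IH] vv' /=; first by rewrite addn0.
by rewrite IH => [|i ik]; [rewrite vv'// addSnnS|rewrite vv'// ltnW].
Qed.

(** The usual candidate for the next problem; [N.-1] is the index that the shift leaves vacant. *)
Definition shifted_input (v : nat -> 'cV[R]_l) (k : nat) : 'cV[R]_l :=
  if (k < N.-1)%N then v k.+1 else vf.

(** Recursive feasibility. Shifted nominal and error trajectories coincide with the earlier
    predictions, so the old constraints cover all stages but the last. There the nominal state is
    the old terminal one, in [Zf], and the suprema in the terminal conditions dominate the risk of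
    [err (j + N)]. *)
Lemma ol_feasible_shift j z v :
  V vf -> terminal_state_condition P A B K W X0 rho c p Zf ->
  terminal_input_condition P A B K W X0 rho d q Zf vf ->
  feasible j z (err j) v ->
  feasible j.+1 (AK *m z + B *m v 0%N + mean P (W j))%R (err j.+1)
    (shifted_input v).
Proof.
move=> Vvf [_ h1] h2 [Vv Zfv cv].
have zE k : (k < N)%N ->
    ol_z P A B K W j.+1 (AK *m z + B *m v 0%N + mean P (W j))%R
      (shifted_input v) k = ol_z P A B K W j z v k.+1.
  move=> kN; apply: ol_z_shift => i ik.
  by rewrite /shifted_input (leq_trans ik)// -ltnS prednK.
have zfE : Zf (ol_z P A B K W j z v N.-1.+1) by rewrite prednK.
have predN : (N.-1 < N)%N by rewrite prednK.
split=> [k kN||k kN].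
- by rewrite /shifted_input; case: ifP => // kN'; apply: Vv; rewrite -(prednK N0).
- suff : Zf (ol_z P A B K W j.+1 (AK *m z + B *m v 0%N + mean P (W j))%R
      (shifted_input v) N.-1.+1) by rewrite prednK.
  rewrite /= zE// /shifted_input ltnn mean_noise.
  exact: (h2 _ zfE).1.
rewrite zE// ol_E_err addSnnS -ol_E_err /shifted_input.
case: ifP => kN'.
  by have := cv k.+1; rewrite -{1}(prednK N0) ltnS => /(_ kN').
(* The remaining case is the new last stage, where [vf] is applied. *)
have -> : k = N.-1.
  by apply/eqP; rewrite eqn_leq (leqNgt N.-1) kN' -ltnS prednK// kN.
rewrite ol_E_err; split=> i.
  apply: (le_trans (h1 _ zfE i)); apply: leeB => //.
  by apply: ereal_sup_ubound; exists (j + N.-1.+1)%N.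
apply: (le_trans ((h2 _ zfE).2 i)); apply: leeB => //.
by apply: ereal_sup_ubound; exists (j + N.-1.+1)%N.
Qed.

Hypothesis Vvf : V vf.
Hypothesis h1 : terminal_state_condition P A B K W X0 rho c p Zf.
Hypothesis h2 : terminal_input_condition P A B K W X0 rho d q Zf vf.
Hypothesis h5 : exists v, feasible 0 (mean P X0) (err 0) v.

(** [cl_optimal] presupposes feasibility, which is propagated scenario by scenario with the shifted
    input as witness. *)
Lemma closed_loop_optimal j w :
  ol_optimal P A B K W g gf rho c p d q V Zf N j (Xcl j w) (Zcl j w) (err j)
    (vstar j w).
Proof.
apply: (cl_optimal hcl); elim: j => [|j IH]; first by rewrite (cl_Z0 hcl).
exists (shifted_input (vstar j w)); rewrite (cl_ZS hcl).
by apply: ol_feasible_shift => //; exact: (cl_optimal hcl IH).1.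
Qed.

Lemma closed_loop_step j w :
  Xcl j.+1 w = (AK *m Xcl j w + B *m vstar j w 0%N + W j w)%R.
Proof.
by rewrite (cl_XS hcl) (cl_U hcl) mulmxDl mulmxDr mulmxA addrA.
Qed.

Lemma closed_loop_state_error j w : Xcl j w = (Zcl j w + err j w)%R.
Proof.
elim: j => [|j IH]; first by rewrite (cl_X0 hcl) (cl_Z0 hcl)/= addrC subrK.
rewrite closed_loop_step (cl_ZS hcl)/= IH mulmxDr.
rewrite -!addrA; congr (_ + _)%R.
rewrite [LHS]addrCA; congr (_ + _)%R.
by rewrite [RHS]addrCA; congr (_ + _)%R; rewrite addrC subrK.
Qed.

Lemma closed_loop_input_measurable j k : (k < N)%N ->
  entrywise_measurable
    ((fun w => vstar j w k) : history_type Xcl j -> 'cV[R]_l).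
Proof. by move=> kN; apply/history_measurableP; exact: (cl_measurable hcl). Qed.

Lemma closed_loop_control_history j :
  entrywise_measurable (Ucl j : history_type Xcl j -> 'cV[R]_l).
Proof.
have -> : Ucl j = fun w => (K *m Xcl j w + vstar j w 0%N)%R.
  by apply/funext => w; exact: (cl_U hcl).
apply: entrywiseD; last exact: closed_loop_input_measurable.
by apply: entrywiseM; exact: process_history.
Qed.

(** Strong induction, because the control at time [j] is measurable for the history of all states up
    to [j]. *)
Lemma closed_loop_measurable j i : (i <= j)%N -> random_vector (Xcl i).
Proof.
elim: j i => [|j IH] i; first by rewrite leqn0 => /eqP->; rewrite (cl_X0 hcl).
rewrite leq_eqVlt => /predU1P[->|]; last exact: IH.
apply/random_vectorE.
have -> : Xcl j.+1 = fun w => (A *m Xcl j w + B *m Ucl j w + W j w)%R.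
  by apply/funext => w; exact: (cl_XS hcl).
apply: entrywiseD; last exact/random_vectorE.
apply: entrywiseD; apply: entrywiseM; first by apply/random_vectorE; exact: IH.
by apply: (history_entrywise Xcl j (Ucl j)) => //; exact: closed_loop_control_history.
Qed.

Lemma closed_loop_state_measurable j : entrywise_measurable (Xcl j).
Proof. by apply/random_vectorE; exact: (closed_loop_measurable j). Qed.

Lemma closed_loop_control_measurable j : entrywise_measurable (Ucl j).
Proof.
apply: (history_entrywise Xcl j (Ucl j) (closed_loop_measurable j)).
exact: closed_loop_control_history.
Qed.

Lemma closed_loop_system_process : system_process A B W Xcl Ucl.
Proof.
split; first exact: (closed_loop_measurable 0).
- by move=> k; apply/history_measurableP; exact: closed_loop_control_history.
- exact: (cl_XS hcl).
Qed.

Lemma err_measurable j : entrywise_measurable (err j).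
Proof.
elim: j => [|j IH] /=.
  by apply: entrywiseB; [apply/random_vectorE|exact: entrywise_cst].
apply: entrywiseB; last exact: entrywise_cst.
by apply: entrywiseD; [exact: entrywiseM|apply/random_vectorE].
Qed.

Lemma closed_loop_risk_constraints j :
  risk_measure P rho -> risk_constraints rho c p d q (Xcl j) (Ucl j).
Proof.
move=> hrho.
(* Only the stage-0 constraints of each problem are needed; there the error is [err j] itself. *)
have tight w := let: And3 _ _ h := (closed_loop_optimal j w).1 in h 0%N N0.
split=> i.
  apply: (risk_le_of_tightened P rho _ (fun w => dotv (c i) (err j w))) => //.
  - by apply: measurable_dotv; exact: closed_loop_state_measurable.
  - by apply: measurable_dotv; exact: err_measurable.
  move=> w; rewrite closed_loop_state_error dotvD addrK.
  exact: (tight w).1.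
apply: (risk_le_of_tightened P rho _ (fun w => dotv (d i) (K *m err j w)%R)) => //.
- by apply: measurable_dotv; exact: closed_loop_control_measurable.
- by apply: measurable_dotv; apply: entrywiseM; exact: err_measurable.
move=> w; rewrite (cl_U hcl) closed_loop_state_error mulmxDr addrAC dotvD addrK.
exact: (tight w).2.
Qed.

Lemma closed_loop_cost_ge Xs Us :
  risk_measure P rho ->
  stationary_cost P g Xs Us \is a fin_num ->
  stochastically_dissipative P A B W g rho c p d q X0 Xs Us ->
  exists e : R, forall L,
    (L%:R * fine (stationary_cost P g Xs Us) + e)%:E <=
    \sum_(0 <= k < L) stage_cost P g (Xcl k) (Ucl k).
Proof.
move=> hrho lsfin [lambda [_ [b hb] hdiss]].
(* Telescoping leaves [lambda (Xcl L) - lambda (Xcl 0)], whose first term is at least [b]. *)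
set ls := fine _; exists (b - lambda (Xcl 0%N))%R => L.
have step k : (ls - lambda (Xcl k) + lambda (Xcl k.+1))%:E <=
    stage_cost P g (Xcl k) (Ucl k).
  have adm : ocp_admissible A B W rho c p d q X0 Xcl Ucl.
    split; [exact: closed_loop_system_process|exact: (cl_X0 hcl)|].
    by move=> i; exact: closed_loop_risk_constraints.
  have := hdiss _ _ adm k.
  have -> : (fun w => A *m Xcl k w + B *m Ucl k w + W k w)%R = Xcl k.+1.
    by apply/funext => w; rewrite (cl_XS hcl).
  rewrite -(fineK lsfin) -/ls.
  case: (stage_cost _ _ _ _) => [s|_|//]; last by rewrite leey.
  by rewrite !lee_fin => ?; lra.
apply: (@le_trans _ _
    (L%:R * ls - lambda (Xcl 0%N) + lambda (Xcl L))%:E).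
  by have := hb _ (closed_loop_measurable L L (leqnn L)); rewrite lee_fin; lra.
elim: L => [|L IH].
  by rewrite big_geq// lee_fin mul0r; lra.
rewrite big_nat_recr//=; apply: le_trans (leeD IH (step L)).
by rewrite -EFinD lee_fin mulrSr mulrDl mul1r; lra.
Qed.

(* Constant random vectors are independent of everything, so the terminal cost
   condition holds pointwise. *)
Lemma terminal_cost_pointwise (ls C : R) y :
  terminal_cost_condition P A B K W g gf N ls%:E vf C ->
  (g y (K *m y + vf)%R)%:E +
    terminal_cost P gf (fun w => AK *m y + B *m vf + W N w)%R <=
  (gf y)%:E + ls%:E + C%:E.
Proof.
move=> h3.
have Ecst (s : R) : 'E_P[fun=> s] = s%:E.
  by rewrite expectation.unlock integral_cst//= probability_setT mule1.
have := h3 (fun=> y); rewrite /terminal_cost /stage_cost /= !Ecst.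
have -> : (fun w => gf (A *m y + B *m (K *m y + vf) + W N w)%R) =
          (fun w => gf (AK *m y + B *m vf + W N w)%R).
  by apply/funext => w; rewrite mulmxDl mulmxDr mulmxA addrA.
move=> h; have {h} : 'E_P[fun w => gf (AK *m y + B *m vf + W N w)%R] <=
    (gf y)%:E - (g y (K *m y + vf)%R)%:E + ls%:E + C%:E.
  apply: h => //; first by apply/random_vectorE; exact: entrywise_cst.
  move=> S T [D mD <-] _; rewrite setTI.
  (* The preimage of [D] under a constant map is everything or empty. *)
  have [Dy|Dy] := pselect (D y).
    rewrite (_ : _ @^-1` D = setT) ?setTI ?probability_setT ?mul1e//.
    by apply/seteqP; split.
  rewrite (_ : _ @^-1` D = set0) ?set0I ?measure0 ?mul0e//.
  by apply/seteqP; split.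
case: ('E_P[_]) => [a|//|]; last by move=> _; rewrite addeNy leNye.
by rewrite -EFinB -!EFinD !lee_fin => ?; lra.
Qed.

(** Turns finiteness of the expected optimal value into finiteness for the input actually
    selected. *)
Lemma ol_value_optimal j w :
  ol_value P A B K W g gf rho c p d q V Zf N j (Xcl j w) (Zcl j w) (err j) =
  ol_cost P A B K W g gf N j (Xcl j w) (vstar j w).
Proof.
have [feas opt] := closed_loop_optimal j w.
apply/eqP; rewrite eq_le; apply/andP; split.
  by apply: ereal_inf_lbound; exists (vstar j w).
by apply: le_ereal_inf_tmp => _ [v fv <-]; exact: opt.
Qed.

(** Independence from the closed-loop history averages out the noise along the closed loop;
    independence from the uncontrolled process identifies open-loop costs with [cost_to_go]. *)
Lemma closed_loop_cost_le (b bf ls C : R) :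
  noise_independent P W Xcl ->
  noise_independent P W (free_process A W X0) ->
  continuous (fun y : 'cV[R]_n * 'cV[R]_l => g y.1 y.2) ->
  (forall x u, (b <= g x u)%R) ->
  measurable_fun [set: borel 'cV[R]_n] (gf : borel 'cV[R]_n -> R) ->
  (forall x, (bf <= gf x)%R) ->
  (b <= ls)%R -> (0 <= C)%R ->
  terminal_cost_condition P A B K W g gf N ls%:E vf C ->
  \int[P]_w ol_value P A B K W g gf rho c p d q V Zf N 0
    (X0 w) (mean P X0) (err 0) < +oo ->
  exists e : R, forall L,
    \sum_(0 <= k < L) stage_cost P g (Xcl k) (Ucl k) <=
    (L%:R * (ls + C) + e)%:E.
Proof.
move=> indX indF cg gb mgf gfb bls C0 h3 fin0.
pose g' x u := (g x u - b)%R; pose gf' x := (gf x - bf)%R.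
have cg' : continuous (fun y : 'cV[R]_n * 'cV[R]_l => g' y.1 y.2).
  by move=> y; apply: cvgB; [exact: cg|exact: cvg_cst].
have g'0 x u : (0 <= g' x u)%R by rewrite subr_ge0.
have mgf' : measurable_fun [set: borel 'cV[R]_n] (gf' : borel 'cV[R]_n -> R).
  by apply: measurable_funB => //; exact: measurable_cst.
have gf'0 x : (0 <= gf' x)%R by rewrite subr_ge0.
pose ctg := cost_to_go P A B K (W 0%N) g' gf'.
pose k0 := (b *+ N + bf)%R.
have olE j x v : ol_cost P A B K W g gf N j x v = ctg N x v + k0%:E.
  by rewrite (ol_cost_addr P A B K W mW g gf b bf)// (ol_cost_cost_to_go _ _ _ _ _ X0).
have ctg0 m x v : 0 <= ctg m x v by exact: cost_to_go_ge0.
have mctg j m (v : Omega -> nat -> 'cV[R]_l) :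
    (forall k, (k < m)%N -> entrywise_measurable (fun w => v w k)) ->
    measurable_fun [set: Omega] (fun w => ctg m (Xcl j w) (v w)).
  by move=> mv; apply: measurable_cost_to_go => //; exact: closed_loop_state_measurable.
have mv j k : (k < N)%N -> entrywise_measurable (fun w => vstar j w k).
  move=> kN; apply: (history_entrywise Xcl j _ (closed_loop_measurable j)).
  exact: closed_loop_input_measurable.
pose s j := \int[P]_w (g' (Xcl j w) (Ucl j w))%:E.
pose a j := \int[P]_w ctg N (Xcl j w) (vstar j w).
have s0 j : 0 <= s j by apply: integral_ge0 => w _; rewrite lee_fin.
have a0 j : 0 <= a j by exact: integral_ge0.
(* The constant [ls + C] once the stage cost is lowered by [b]; the shift [bf] of the terminal cost
   cancels. *)
pose r := (ls - b + C)%R.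
have r0 : (0 <= r)%R by rewrite addr_ge0// subr_ge0.
have tail0 y : (g' y (K *m y + vf)%R)%:E +
    \int[P]_w (gf' (AK *m y + B *m vf + W 0%N w)%R)%:E <= (gf' y)%:E + r%:E.
  have := terminal_cost_pointwise ls C y h3.
  rewrite (terminal_cost_addr P gf bf)//; last first.
    by apply: entrywiseD; [exact: entrywise_cst|apply/random_vectorE].
  rewrite /terminal_cost expectation.unlock.
  (* The terminal condition involves [W N], whereas [cost_to_go] averages over [W 0]. *)
  rewrite (integral_same_law P (W N : Omega -> borel 'cV[R]_n)
    (W 0%N : Omega -> borel 'cV[R]_n)
    (fun x => (gf' (AK *m y + B *m vf + x)%R)%:E) (mW _) (mW _) (WW0 _)).
    rewrite /gf' /g' /r; case: (\int[P]_w _) => [i| |]//.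
      by rewrite -!EFinD !lee_fin => ?; lra.
    by move=> _; rewrite addeNy leNye.
  apply/measurable_EFinP; apply: measurable_borel_comp => //.
  apply: entrywiseD; first exact: entrywise_cst.
  by apply/random_vectorE; exact: measurable_id.
have step j : s j + a j.+1 <= a j + r%:E.
  pose v1 w := fun k => vstar j w k.+1.
  have mv1 k : (k < N.-1)%N -> entrywise_measurable (fun w => v1 w k).
    by move=> kN; apply: mv; rewrite -(prednK N0).
  (* Splits off the first stage, with the closed-loop history up to [j] as the information
     independent of [W j]. *)
  have -> : a j = s j + \int[P]_w ctg N.-1 (Xcl j.+1 w) (v1 w).
    rewrite /a -(prednK N0).
    have := cost_to_go_step P A B K (W 0%N) g' gf' (mW 0%N) cg' g'0 mgf' gf'0 N.-1
      (idfun : Omega -> history_type Xcl j) (W j) (Xcl j) (vstar j)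
      (measurable_to_history Xcl j (closed_loop_measurable j)) (mW _) (WW0 _)
      (history_independent P _ _ _ (indX j))
      (process_history Xcl j j (leqnn j)).
    rewrite prednK// => /(_ (closed_loop_input_measurable j)) ->.
    congr (_ + _); apply: eq_integral => w _; first by rewrite (cl_U hcl).
    by rewrite closed_loop_step.
  rewrite -addeA leeD2l//.
  rewrite -(integral_addr P _ r (mctg j.+1 N.-1 v1 mv1))//.
  apply: ge0_le_integral => //.
  - exact: mctg (mv j.+1).
  - by apply: emeasurable_funD => //; exact: mctg.
  move=> w _.
  (* Optimality at time [j.+1] is tested against the shifted input; the added constant [k0]
     cancels. *)
  apply: (@le_trans _ _ (ctg N (Xcl j.+1 w) (shifted_input (vstar j w)))).
    have [feas _] := closed_loop_optimal j w.
    have [_ opt] := closed_loop_optimal j.+1 w.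
    have := opt (shifted_input (vstar j w)); rewrite (cl_ZS hcl).
    move=> /(_ (ol_feasible_shift _ _ _ Vvf h1 h2 feas)).
    by rewrite !olE leeD2rE.
  (* Seen as [N.-1] stages plus one, the shifted input ends in [vf] and otherwise agrees with
     [v1]. *)
  rewrite -{1}(prednK N0).
  apply: le_trans (cost_to_go_terminal P A B K (W 0%N) g' gf' (mW 0%N) cg' g'0 mgf'
    gf'0 vf r N.-1 _ _ r0 tail0 _) _; first by rewrite /shifted_input ltnn.
  rewrite leeD2r// le_eqVlt; apply/orP; left; apply/eqP.
  by apply: eq_cost_to_go => k kN; rewrite /shifted_input kN.
have afin : a 0%N < +oo.
  move: fin0.
  rewrite (eq_integral (fun w => ctg N (Xcl 0%N w) (vstar 0%N w) + k0%:E)); last first.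
    by move=> w _; rewrite -(olE 0%N) -ol_value_optimal (cl_X0 hcl) (cl_Z0 hcl).
  rewrite integral_addr//; last exact: mctg (mv 0%N).
  by rewrite -/(a 0%N); case: (a 0%N) => [x| |]; rewrite ?addye ?ltry ?ltNyr.
exists (fine (a 0%N)) => L.
(* The term [a L] carries the induction; being nonnegative, it is dropped afterwards. *)
have bound : \sum_(0 <= k < L) s k + a L <= (L%:R * r)%:E + a 0%N.
  elim: L => [|L IH]; first by rewrite big_geq// mul0r.
  rewrite big_nat_recr//= -addeA (le_trans (leeD2l _ (step L)))// addeA.
  rewrite (le_trans (leeD2r _ IH))// addeAC -EFinD.
  by rewrite leeD2r// lee_fin mulrSr mulrDl mul1r.
have -> : \sum_(0 <= k < L) stage_cost P g (Xcl k) (Ucl k) =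
    \sum_(0 <= k < L) s k + (L%:R * b)%:E.
  elim: L {bound} => [|L IH]; first by rewrite !big_geq// mul0r adde0.
  rewrite !big_nat_recr//= IH (stage_cost_addr P g b)//; last 2 first.
  - exact: closed_loop_state_measurable.
  - exact: closed_loop_control_measurable.
  rewrite mulrSr mulrDl mul1r EFinD addeACA; congr (_ + _ + _).
  by rewrite /stage_cost expectation.unlock.
apply: (@le_trans _ _ (((L%:R * r)%:E + a 0%N) + (L%:R * b)%:E)).
  by rewrite leeD2r// (le_trans _ bound)// leeDl.
rewrite -(fineK (x := a 0%N)) ?ge0_fin_numE// -!EFinD lee_fin /r.
by rewrite /=; lra.
Qed.

End closed_loop_analysis.

(** * Limits of averages *)

Lemma le_limn_esup {R : realType} (u v : (\bar R)^nat) :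
  (forall k, u k.+1 <= v k.+1) -> limn_esup u <= limn_esup v.
Proof.
move=> uv; rewrite !limn_esup_lim.
apply: lee_lim; [exact: is_cvg_esups|exact: is_cvg_esups|].
(* Tail suprema are compared from index 1 on, so index 0 never enters. *)
exists 1%N => // m /= m1; apply: ge_ereal_sup => _ [k /= mk <-].
apply: (@le_trans _ _ (v k)); last by apply: ereal_sup_ubound; exists k.
by case: k mk => [|k] mk; [move: (leq_trans m1 mk)|exact: uv].
Qed.

Lemma le_limn_einf {R : realType} (u v : (\bar R)^nat) :
  (forall k, u k.+1 <= v k.+1) -> limn_einf u <= limn_einf v.
Proof.
move=> uv; rewrite -[leLHS]oppeK -[leRHS]oppeK -!limn_esupN leeN2.
by apply: le_limn_esup => k; rewrite leeN2.
Qed.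

Lemma cvg_affine_average {R : realType} (t e : R) :
  (L%:R^-1 * (L%:R * t + e))%:E @[L --> \oo] --> t%:E.
Proof.
apply: cvg_EFin; first exact: nearW.
(* The shift avoids [L = 0], where the inverse is 0 by convention, and turns the error term into a
   multiple of the harmonic sequence. *)
rewrite -cvg_shiftS.
rewrite (_ : (fun L : nat => _) = (fun L : nat => t + e * harmonic L)%R).
  suff : (t + e * harmonic L)%R @[L --> \oo] --> (t + e * 0)%R.
    by rewrite mulr0 addr0.
  apply: cvgD; first exact: cvg_cst.
  by apply: cvgM; [exact: cvg_cst|exact: cvg_harmonic].
apply/funext => L; rewrite /= mulrDr mulrA mulVf ?mul1r; last by rewrite pnatr_eq0.
by rewrite mulrC.
Qed.

Lemma average_cost_le {disp : measure_display} {Omega : measurableType disp}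
    {R : realType} (P : probability Omega R) {n l : nat}
    (g : 'cV[R]_n -> 'cV[R]_l -> R) X U L (t : R) :
  \sum_(0 <= k < L) stage_cost P g (X k) (U k) <= t%:E ->
  average_cost P g X U L <= (L%:R^-1 * t)%:E.
Proof.
by move=> h; rewrite /average_cost EFinM lee_wpmul2l// lee_fin invr_ge0.
Qed.

Lemma average_cost_ge {disp : measure_display} {Omega : measurableType disp}
    {R : realType} (P : probability Omega R) {n l : nat}
    (g : 'cV[R]_n -> 'cV[R]_l -> R) X U L (t : R) :
  t%:E <= \sum_(0 <= k < L) stage_cost P g (X k) (U k) ->
  (L%:R^-1 * t)%:E <= average_cost P g X U L.
Proof.
by move=> h; rewrite /average_cost EFinM lee_wpmul2l// lee_fin invr_ge0.
Qed.

Theorem mainTheorem5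
  (disp : measure_display) (Omega : measurableType disp) (R : realType)
  (P : probability Omega R) (n l : nat)
  (* system *)
  (A : 'M[R]_n) (B : 'M[R]_(n, l)) (hAB : controllable A B)
  (W : nat -> Omega -> 'cV[R]_n)
  (hWmeas : forall k, random_vector (W k))
  (hWiid : iid P W)
  (hWmean : finite_mean P (W 0%N))
  (X0 : Omega -> 'cV[R]_n) (hX0 : random_vector X0) (hX0mean : finite_mean P X0)
  (hWindep : forall (X : nat -> Omega -> 'cV[R]_n) (U : nat -> Omega -> 'cV[R]_l),
     system_process A B W X U -> X 0%N = X0 -> noise_independent P W X)
  (* costs *)
  (g : 'cV[R]_n -> 'cV[R]_l -> R)
  (hgcont : continuous (fun y : 'cV[R]_n * 'cV[R]_l => g y.1 y.2))
  (hgbdd : exists b : R, forall x u, (b <= g x u)%R)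
  (gf : 'cV[R]_n -> R)
  (hgfmeas : measurable_fun [set: borel 'cV[R]_n] (gf : borel 'cV[R]_n -> R))
  (hgfbdd : exists b : R, forall x, (b <= gf x)%R)
  (* constraints *)
  (rho : (Omega -> R) -> \bar R) (hrho : risk_measure P rho)
  (mx mu : nat)
  (c : 'I_mx -> 'cV[R]_n) (p : 'I_mx -> R)
  (d : 'I_mu -> 'cV[R]_l) (q : 'I_mu -> R)
  (* open-loop problem *)
  (K : 'M[R]_(l, n)) (hK : schur_stable (A + B *m K)%R)
  (V : set 'cV[R]_l) (Zf : set 'cV[R]_n) (N : nat) (hN : (0 < N)%N)
  (* closed loop *)
  (Xcl : nat -> Omega -> 'cV[R]_n) (Ucl : nat -> Omega -> 'cV[R]_l)
  (Zcl : nat -> Omega -> 'cV[R]_n) (vstar : nat -> Omega -> nat -> 'cV[R]_l)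
  (hcl : closed_loop P A B K W X0 g gf rho c p d q V Zf N Xcl Ucl Zcl vstar)
  (* stationary pair *)
  (Xs : nat -> Omega -> 'cV[R]_n) (Us : nat -> Omega -> 'cV[R]_l)
  (hstat : stationary_pair P A B W rho c p d q Xs Us)
  (hls : stationary_cost P g Xs Us \is a fin_num)
  (* (i) *)
  (h1 : terminal_state_condition P A B K W X0 rho c p Zf)
  (* (ii) *)
  (vf : 'cV[R]_l) (hvf : V vf)
  (h2 : terminal_input_condition P A B K W X0 rho d q Zf vf)
  (* (iii) *)
  (Cf : R) (hCf : (0 <= Cf)%R)
  (h3 : terminal_cost_condition P A B K W g gf N (stationary_cost P g Xs Us) vf Cf)
  (* (iv) *)
  (h4 : stochastically_dissipative P A B W g rho c p d q X0 Xs Us)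
  (* (v), with finite expected optimal cost *)
  (h5 : exists v, ol_feasible P A B K W rho c p d q V Zf N 0
                    (mean P X0) (err P A B K W X0 0) v)
  (h5fin : \int[P]_w ol_value P A B K W g gf rho c p d q V Zf N 0
             (X0 w) (mean P X0) (err P A B K W X0 0) < +oo) :
  [/\ stationary_cost P g Xs Us <= limn_einf (average_cost P g Xcl Ucl),
      limn_einf (average_cost P g Xcl Ucl) <= limn_esup (average_cost P g Xcl Ucl) &
      limn_esup (average_cost P g Xcl Ucl) <= stationary_cost P g Xs Us + Cf%:E] /\
  (terminal_cost_condition P A B K W g gf N (stationary_cost P g Xs Us) vf 0%R ->
   average_cost P g Xcl Ucl @ \oo --> stationary_cost P g Xs Us).
Proof.
have [_ WW0] := hWiid.
have [b gb] := hgbdd; have [bf gfb] := hgfbdd.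
have [[Xs0 Us_hist _] _ _ _ _ _ _] := hstat.
(* The stationary cost is an average of values of [g], all at least [b]; this makes the step
   constant of the upper bound nonnegative. *)
have bls : (b <= fine (stationary_cost P g Xs Us))%R.
  have mXs0 : forall i, (i <= 0)%N -> random_vector (Xs i).
    by move=> i; rewrite leqn0 => /eqP->.
  rewrite -lee_fin fineK// /stationary_cost (stage_cost_addr P g b)//.
  - rewrite leeDr// /stage_cost expectation.unlock; apply: integral_ge0 => w _.
    by rewrite lee_fin subr_ge0.
  - exact/random_vectorE.
  - by apply: (history_entrywise Xs 0) => //; apply/history_measurableP.
have indX : noise_independent P W Xcl.
  apply: (hWindep Xcl Ucl); last exact: cl_X0 hcl.
  exact: closed_loop_system_process hWmeas hX0 hN hcl.
have indF : noise_independent P W (free_process A W X0).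
  by apply: (hWindep _ (fun _ _ => 0%R)) => //; exact: free_system_process.
(* Kept general in [C] to serve both for [Cf] and for 0. *)
have upper C : (0 <= C)%R ->
    terminal_cost_condition P A B K W g gf N (stationary_cost P g Xs Us) vf C ->
    exists e : R, forall L, average_cost P g Xcl Ucl L <=
      (L%:R^-1 * (L%:R * (fine (stationary_cost P g Xs Us) + C) + e))%:E.
  move=> C0; rewrite -[X in terminal_cost_condition _ _ _ _ _ _ _ _ X](fineK hls) => h3C.
  have [e he] := closed_loop_cost_le P A B K W X0 g gf rho mx mu c p d q V Zf N
    Xcl Ucl Zcl vstar vf hWmeas WW0 hX0 hN hcl hvf h1 h2 h5 b bf _ C indX indF
    hgcont gb hgfmeas gfb bls C0 h3C h5fin.
  by exists e => L; exact: average_cost_le.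
have [e lower] : exists e : R, forall L,
    (L%:R^-1 * (L%:R * fine (stationary_cost P g Xs Us) + e))%:E <=
    average_cost P g Xcl Ucl L.
  have [e he] := closed_loop_cost_ge P A B K W X0 g gf rho mx mu c p d q V Zf N
    Xcl Ucl Zcl vstar vf hWmeas WW0 hX0 hN hcl hvf h1 h2 h5 Xs Us hrho hls h4.
  by exists e => L; exact: average_cost_ge.
split; last first.
  move=> /(upper _ (lexx _))[e' up]; rewrite -(fineK hls).
  apply: (squeeze_cvge _ (cvg_affine_average _ e) (cvg_affine_average _ e')).
  apply: nearW => L; rewrite lower/=.
  by have := up L; rewrite addr0.
have [e' up] := upper _ hCf h3.
rewrite -(fineK hls); split.
- rewrite -(cvg_limn_einf_sup (cvg_affine_average _ e)).1.
  by apply: le_limn_einf => k; exact: lower.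
- exact: limn_einf_sup.
- rewrite -EFinD -(cvg_limn_einf_sup (cvg_affine_average _ e')).2.
  by apply: le_limn_esup => k; exact: up.
Qed.
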